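(* For every $n\in\mathbb{N}=\{1,2,\dots\}$, $M\in\{0,1,\dots,n-1\}$ and $q\in(0,1)$, $$\mathcal{P}_n^q(\mathcal{S}(n,M))=\begin{cases}\dfrac{1-q}{1-q^n}\,q^{n-M-1}(1-q^M)\displaystyle\sum_{j=M+1}^n\frac{1}{1-q^{j-1}}, & \text{if } M\ge1;\\[2ex] \dfrac{1-q}{1-q^n}\,q^{n-1}, & \text{if } M=0,\end{cases}$$ where $\mathcal{P}_n^q(\mathcal{S}(n,M))$ is the probability that strategy $\mathcal{S}(n,M)$ selects the item of highest rank when the arrival order has the Mallows distribution with parameter $q$.
   Context: Let $S_n$ be the set of permutations $\sigma=\sigma_1\sigma_2\cdots\sigma_n$ of $[n]=\{1,\dots,n\}$, and let $\mathrm{inv}(\sigma)$ be the number of inversions of $\sigma$, i.e. the number of pairs $i<j$ with $\sigma_i>\sigma_j$. For $q>0$, the Mallows distribution with parameter $q$ is the probability measure $P_n^q$ on $S_n$ for which $P_n^q(\sigma)$ is proportional to $q^{\mathrm{inv}(\sigma)}$. Secretary problem with Mallows-biased arrival: $n$ items with distinct ranks $1,\dots,n$ arrive one at a time, and $\sigma_j$ is the rank of the $j$th item to arrive, where $\sigma\in S_n$ is distributed according to $P_n^q$. The number $n$ is the highest rank and $1$ is the lowest. At each stage the observer knows only the relative ranks of the items that have arrived so far, and must either select the current item (the process then ends) or reject it irrevocably and continue; if the first $n-1$ items are rejected, the $n$th item must be accepted. Success means selecting the item of rank $n$. For $0\le M\le n-1$, the strategy $\mathcal{S}(n,M)$ rejects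 the first $M$ items and then selects the first later-arriving item whose rank is higher than that of each of the first $M$ items, if such an item exists (for $M=0$ it selects the first item). $\mathcal{P}_n^q(\mathcal{S}(n,M))$ denotes the $P_n^q$-probability that this strategy selects the item of rank $n$. *)

(* Defs.v *)
From mathcomp Require Import all_boot all_order all_fingroup all_algebra.

Set Implicit Arguments.
Unset Strict Implicit.
Unset Printing Implicit Defensive.

Import Order.TTheory GRing.Theory Num.Theory.
Local Open Scope ring_scope.

(* Arrival times and ranks are both 0-based: [s j : 'I_n] stands for rank
   [(s j).+1] of the item arriving in position [j.+1]; the best item is the one
   with [(s j).+1 = n]. *)

Definition inv (n : nat) (s : 'S_n) : nat :=
  #|[set p : 'I_n * 'I_n | (p.1 < p.2)%N && (s p.2 < s p.1)%N]|.

Definition mallows (R : realFieldType) (n : nat) (q : R) (s : 'S_n) : R :=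
  q ^+ inv s / \sum_(t : 'S_n) q ^+ inv t.

Definition mallowsP (R : realFieldType) (n : nat) (q : R) (A : {set 'S_n}) : R :=
  \sum_(s in A) mallows q s.

(* The second disjunct is the rule of the strategy; the first is the obligation
   to take the last item once every other one has been rejected. *)
Definition accepts (n M : nat) (s : 'S_n) (j : 'I_n) : bool :=
  (j.+1 == n) || ((M <= j)%N && [forall i : 'I_n, (i < M)%N ==> (s i < s j)%N]).

(* [enum 'I_n] is increasing, so this is the first accepted position; it is
   [None] only for [n = 0]. *)
Definition selected (n M : nat) (s : 'S_n) : option 'I_n :=
  ohead [seq j <- enum 'I_n | accepts M s j].

Definition success (n M : nat) : {set 'S_n} :=
  [set s | if selected M s is Some j then (s j).+1 == n else false].

Definition success_prob (R : realFieldType) (n M : nat) (q : R) : R :=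
  mallowsP q (success n M).

(* Main.v *)
(** Call a position [j] of [s] a record when [s j] exceeds all earlier values.
    The strategy [S(n,M)] succeeds exactly when there is one and only one record
    at a position [>= M]: the selected item is the first such record, and the
    best item is the last one.  Writing a permutation of [n.+1] letters as its
    last value [k] together with a permutation [t] of [n] letters adds [n - k]
    inversions, and adds a record iff [k] is maximal.  Hence under the Mallows
    measure the last position is a record with probability
    [(1 - q) / (1 - q ^+ n.+1)], independently of the earlier records, and the
    law of the number of late records obeys a first-order recursion in [n]. *)

Require Import Defs.
From mathcomp Require Import all_boot all_order all_fingroup all_algebra.
From mathcomp Require Import ring zify.

Set Implicit Arguments.
Unset Strict Implicit.
Unset Printing Implicit Defensive.

Import Order.TTheory GRing.Theory Num.Theory.
Local Open Scope ring_scope.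

(** * Success of the strategy in terms of records *)

Lemma ohead_filter_enum (n : nat) (P : pred 'I_n) (j : 'I_n) : P j ->
  exists i : 'I_n, [/\ ohead [seq k <- enum 'I_n | P k] = Some i, P i
    & forall k, P k -> (i <= k)%N].
Proof.
move=> Pj.
have srt : sorted (fun a b : 'I_n => (a < b)%N) [seq k <- enum 'I_n | P k].
  apply: sorted_filter; first by move=> a b c; apply: ltn_trans.
  have := iota_ltn_sorted 0 n; rewrite -val_enum_ord.
  by rewrite sorted_map.
have memP k : (k \in [seq k <- enum 'I_n | P k]) = P k.
  by rewrite mem_filter mem_enum andbT.
case E: [seq k <- enum 'I_n | P k] srt memP => [|i s] /= srt memP.
  by have := memP j; rewrite in_nil Pj.
exists i; split=> //; first by rewrite -memP mem_head.
move=> k; rewrite -memP inE => /orP[/eqP->//|ks].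
have tr : transitive (fun a b : 'I_n => (a < b)%N).
  by move=> a b c; apply: ltn_trans.
by have /allP/(_ k ks)/ltnW := order_path_min tr srt.
Qed.

Definition is_record (n : nat) (s : 'S_n) (j : 'I_n) : bool :=
  [forall i : 'I_n, (i < j)%N ==> (s i < s j)%N].

Definition late_records (n M : nat) (s : 'S_n) : nat :=
  #|[set j : 'I_n | (M <= j)%N && is_record s j]|.

(** Late records are accepted, so none precedes the selected position, and none can follow the best
    item. Conversely, the selected position and the position of the best item are both forced to be
    the unique late record. *)
Lemma successE (n M : nat) (s : 'S_n) : (M < n)%N ->
  (s \in success n M) = (late_records M s == 1%N).
Proof.
move=> ltMn; have n_gt0 : (0 < n)%N by apply: leq_ltn_trans ltMn.
have accL (j : 'I_n) : j.+1 = n -> accepts M s j.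
  by move=> e; rewrite /accepts e eqxx.
have accR (j : 'I_n) : (M <= j)%N -> is_record s j -> accepts M s j.
  move=> Mj /forallP rj; apply/orP; right; rewrite Mj.
  by apply/forallP=> i; apply/implyP=> iM; apply: (implyP (rj i)); lia.
have predn_lt : (n.-1 < n)%N by rewrite prednK.
have [j [hj accj minj]] :=
  ohead_filter_enum (accL (Ordinal predn_lt) (prednK n_gt0)).
have Mj : (M <= j)%N.
  by case/orP: accj => [/eqP|/andP[]//]; lia.
rewrite inE /selected hj; apply/eqP/cards1P=> [sj|[r /setP hr]].
  have sj_max i : (s i <= s j)%N by have := ltn_ord (s i); lia.
  have rj : is_record s j.
    apply/forallP=> i; apply/implyP=> ij; rewrite ltn_neqAle sj_max andbT.
    by apply: contraTneq ij => /ord_inj/perm_inj->; rewrite ltnn.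
  exists j; apply/setP=> i; rewrite !inE; apply/andP/eqP=> [[Mi ri]|-> //].
  have := minj _ (accR _ Mi ri); rewrite leq_eqVlt => /orP[/eqP/ord_inj->//|ji].
  by have := implyP (forallP ri j) ji; rewrite ltnNge sj_max.
have recE (i : 'I_n) : (M <= i)%N && is_record s i = (i == r) by have := hr i; rewrite !inE.
have /andP[Mr rr] : (M <= r)%N && is_record s r by rewrite recE.
have jr : (j <= r)%N by apply/minj/accR.
(* The largest item up to an accepted position is itself a late record. *)
have r_le_j : (r <= j)%N.
  case: (@arg_maxnP _ j (fun i : 'I_n => (i <= j)%N) (fun i => s i : nat) (leqnn j)).
  move=> p /= pj maxp0.
  have maxp (i : 'I_n) : (i <= j)%N -> (s i <= s p)%N := maxp0 i.
  have [/orP[/eqP|/andP[_ /forallP acc]]] := accj; first by have := ltn_ord r; lia.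
  have Mp : (M <= p)%N.
    rewrite leqNgt; apply/negP=> pM; have := implyP (acc p) pM.
    by by rewrite ltnNge maxp.
  suff /eqP <- : p == r by [].
  rewrite -recE Mp; apply/forallP=> i; apply/implyP=> ip.
  rewrite ltn_neqAle maxp ?(leq_trans (ltnW ip)) // andbT.
  by apply: contraTneq ip => /ord_inj/perm_inj->; rewrite ltnn.
have -> : j = r by apply: ord_inj; lia.
(* The best item sits at [m]. It cannot precede the record [r], so [m] is itself a late record. *)
pose m := (s^-1)%g (Ordinal predn_lt).
have sm : s m = n.-1 :> nat by rewrite permKV.
have rm : (r <= m)%N.
  rewrite leqNgt; apply/negP=> mr; have := implyP (forallP rr m) mr.
  by have := ltn_ord (s r); lia.
suff /eqP <- : m == r by rewrite sm prednK.
rewrite -recE (leq_trans Mr rm); apply/forallP=> i; apply/implyP=> im.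
rewrite sm ltn_neqAle -ltnS prednK // ltn_ord andbT.
by apply: contraTneq im; rewrite -sm => /ord_inj/perm_inj->; rewrite ltnn.
Qed.

(** * Removing the last letter of a permutation *)

Lemma big_perm_lift (R : nmodType) (n : nat) (F : 'S_n.+1 -> R) :
  \sum_s F s = \sum_(k < n.+1) \sum_(t : 'S_n) F (lift_perm ord_max k t).
Proof.
pose h (p : 'I_n.+1 * 'S_n) := lift_perm ord_max p.1 p.2.
have h_inj : injective h.
  move=> [k t] [k' t']; rewrite /h /= => e.
  have ek : k = k' by have := congr1 (fun s : 'S__ => s ord_max) e; rewrite !lift_perm_id.
  move: e; rewrite -{}ek => e; congr (_, _); apply/permP=> i.
  have := congr1 (fun s : 'S__ => s (lift ord_max i)) e.
  by rewrite !lift_perm_lift => /lift_inj.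
have h_bij : bijective h.
  apply: inj_card_bij => //.
  by rewrite card_prod card_ord !card_Sn factS.
by rewrite (reindex h) /= ?pair_big //; apply: onW_bij.
Qed.

Lemma widen_lift_max (n : nat) (i : 'I_n) :
  widen_ord (leqnSn n) i = lift ord_max i.
Proof. by apply: ord_inj; rewrite lift_max. Qed.

Lemma ltn_lift (n : nat) (h : 'I_n.+1) (i j : 'I_n) :
  (lift h i < lift h j)%N = (i < j)%N.
Proof. by rewrite !ltnNge /= leq_bump2. Qed.

Lemma inv_lift_perm (n : nat) (k : 'I_n.+1) (t : 'S_n) :
  Defs.inv (lift_perm ord_max k t) = (Defs.inv t + (n - k))%N.
Proof.
have invE m (s : 'S_m) :
    Defs.inv s = (\sum_(i < m) \sum_(j < m) ((i < j) && (s j < s i)))%N.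
  rewrite /Defs.inv cardsE -sum1_card big_mkcond pair_big /=.
  by apply: eq_bigr => -[i j] _; rewrite unfold_in /=; case: ifP.
rewrite !invE big_ord_recr /= [X in (_ + X)%N]big1 => [|j _]; last first.
  by rewrite ltnNge -ltnS ltn_ord.
rewrite addn0.
under eq_bigr => i _.
  rewrite big_ord_recr /= ltn_ord !widen_lift_max lift_perm_lift lift_perm_id /=.
  under eq_bigr => j _ do
    rewrite widen_lift_max lift_perm_lift ltn_lift.
  over.
rewrite big_split; congr addn => /=.
have bumpE (i : 'I_n) : (k < bump k i)%N = (k <= i)%N by rewrite /bump; lia.
under eq_bigr => i _ do rewrite bumpE.
(* The last position is inverted with each value of [t] that is at least [k]; as [t] is a bijection,
   their number depends on [k] alone. *)
have -> : (\sum_(i < n) (k <= t i) = \sum_(i < n) (k <= i))%N.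
  by rewrite [RHS](reindex_inj (@perm_inj _ t)).
rewrite -(big_mkord xpredT (fun i => (k <= i)%N : nat)).
rewrite (big_cat_nat _ (n := k)) //=; last by rewrite -ltnS.
rewrite big_nat big1 => [|i /andP[_]]; last by rewrite ltnNge => /negPf->.
rewrite big_nat (eq_bigr (fun=> 1%N)) => [|i /andP[->]//].
by rewrite -big_nat sum_nat_const_nat muln1.
Qed.

Lemma late_records_lift_perm (n M : nat) (k : 'I_n.+1) (t : 'S_n) :
  late_records M (lift_perm ord_max k t)
  = (late_records M t + ((M <= n) && (k == ord_max)))%N.
Proof.
have recE m (s : 'S_m) :
    late_records M s = (\sum_(j < m) ((M <= j) && is_record s j))%N.
  rewrite /late_records cardsE -sum1_card big_mkcond /=.
  by apply: eq_bigr => j _; rewrite unfold_in /=; case: ifP.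
rewrite !recE big_ord_recr /=; congr (_ + nat_of_bool (_ && _))%N.
  apply: eq_bigr => j _; rewrite widen_lift_max; congr (nat_of_bool (_ && _)).
  apply/forallP/forallP => H i.
    by have := H (lift ord_max i); rewrite !lift_perm_lift !ltn_lift.
  case: (unliftP ord_max i) => [i' ->|->].
    by rewrite !lift_perm_lift !ltn_lift.
  by rewrite lift_max /= ltnNge (ltnW (ltn_ord j)).
apply/forallP/eqP => [H|-> i].
  case: (unliftP ord_max k) => [k' ek|//].
  (* If [k] is not maximal, the position where [t] takes the value [k'] refutes the record:
     inserting [k] raises that value to [k + 1]. *)
  have : (lift ord_max ((t^-1)%g k') < @ord_max n)%N by rewrite lift_max ltn_ord.
  move/(implyP (H _)); rewrite lift_perm_lift lift_perm_id permKV ek /= /bump.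
  by rewrite (leqNgt n k') (ltn_ord k') /= ltnNge leq_addl.
apply/implyP; rewrite lift_perm_id; case: (unliftP ord_max i) => [i' ->|->].
  by rewrite lift_perm_lift !lift_max => _; apply: ltn_ord.
by rewrite ltnn.
Qed.

(** * The law of the number of late records *)

Section RecordLaw.
Variables (R : realFieldType) (q : R).
Hypotheses (q_gt0 : 0 < q) (q_lt1 : q < 1).

Let Z (n : nat) : R := \sum_(t : 'S_n) q ^+ Defs.inv t.

(** An arbitrary test function [f] makes the recursion in [n] close up: an additional record
    replaces [f] by [f \o succn]. *)
Definition late_records_mean (M n : nat) (f : nat -> R) : R :=
  \sum_(s : 'S_n) mallows q s * f (late_records M s).

Local Notation E := late_records_mean.

Lemma mallows_norm_gt0 n : 0 < Z n.
Proof.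
rewrite /Z (bigD1 1%g) //= ltr_wpDr ?exprn_gt0 //.
by apply: sumr_ge0 => t _; rewrite exprn_ge0 // ltW.
Qed.

Lemma one_minus_expr_gt0 n : (0 < n)%N -> 0 < 1 - q ^+ n.
Proof. by move=> n_gt0; rewrite subr_gt0 exprn_ilt1 ?ltW // -lt0n. Qed.

Lemma sum_expr_rev n : \sum_(k < n) q ^+ (n - k) = q * (1 - q ^+ n) / (1 - q).
Proof.
have q1 : 1 - q != 0 by rewrite subr_eq0 gt_eqF.
rewrite (reindex_inj rev_ord_inj) /=.
under eq_bigr => k _ do rewrite subKn ?exprS //.
rewrite -mulr_sumr; have := subrX1 q n => h.
have -> : 1 - q ^+ n = (1 - q) * \sum_(i < n) q ^+ i by rewrite -[LHS]opprB h; ring.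
by field.
Qed.

(** Summing over the last value yields the next factor of the q-factorial. *)
Lemma mallows_normS n : Z n.+1 = (1 - q ^+ n.+1) / (1 - q) * Z n.
Proof.
have q1 : 1 - q != 0 by rewrite subr_eq0 gt_eqF.
rewrite /Z big_perm_lift.
under eq_bigr => k _ do under eq_bigr => t _ do rewrite inv_lift_perm exprD mulrC.
under eq_bigr => k _ do rewrite -mulr_sumr.
rewrite -mulr_suml big_ord_recr /= subnn sum_expr_rev; congr (_ * _).
by rewrite exprS; field.
Qed.

Lemma late_records_meanE M n f :
  E M n f = (\sum_(s : 'S_n) q ^+ Defs.inv s * f (late_records M s)) / Z n.
Proof.
by rewrite mulr_suml; apply: eq_bigr => s _; rewrite /mallows mulrAC.
Qed.

Lemma late_records_mean_base M f : E M M f = f 0%N.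
Proof.
have rec0 (s : 'S_M) : late_records M s = 0%N.
  by apply: eq_card0 => j; rewrite !inE leqNgt ltn_ord.
rewrite late_records_meanE; under eq_bigr => s _ do rewrite rec0.
by rewrite -mulr_suml mulrAC divff ?mul1r // gt_eqF // mallows_norm_gt0.
Qed.

Lemma late_records_meanS M n f : (M <= n)%N ->
  E M n.+1 f = (1 - q) / (1 - q ^+ n.+1) * E M n (f \o succn)
             + q * (1 - q ^+ n) / (1 - q ^+ n.+1) * E M n f.
Proof.
move=> Mn.
have q1 : 1 - q != 0 by rewrite subr_eq0 gt_eqF.
have qn : 1 - q ^+ n.+1 != 0 by rewrite gt_eqF // one_minus_expr_gt0.
have Zn : Z n != 0 by rewrite gt_eqF // mallows_norm_gt0.
rewrite !late_records_meanE mallows_normS big_perm_lift.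
under eq_bigr => k _.
  under eq_bigr => t _ do
    rewrite inv_lift_perm late_records_lift_perm Mn exprD mulrAC mulrC /=.
  rewrite -mulr_sumr; over.
(* The maximal last value, of weight 1, is split off: it alone adds a record. *)
rewrite big_ord_recr /= subnn expr0 mul1r eqxx.
under eq_bigr => k _.
  rewrite -val_eqE /= ltn_eqF //; under eq_bigr => t _ do rewrite addn0.
  over.
under [X in _ + X]eq_bigr => t _ do rewrite addn1.
rewrite -mulr_suml sum_expr_rev /=.
by field; rewrite q1 Zn qn.
Qed.

(** The shifted indicator of 0 vanishes, so only the second term of the recursion survives and the
    product of its coefficients telescopes. *)
Lemma no_late_record_prob M n : (0 < M)%N -> (M <= n)%N ->
  E M n (fun c => (c == 0%N)%:R) = q ^+ (n - M) * (1 - q ^+ M) / (1 - q ^+ n).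
Proof.
move=> M_gt0 /subnKC <-; rewrite addKn.
have nz i : 1 - q ^+ (M + i) != 0.
  by rewrite gt_eqF // one_minus_expr_gt0 // addn_gt0 M_gt0.
elim: (n - M)%N => [|i IH].
  by rewrite addn0 late_records_mean_base mul1r divff //; have := nz 0%N; rewrite addn0.
rewrite addnS late_records_meanS ?leq_addr // IH.
rewrite [E _ _ _]big1 => [|s _]; last by rewrite /= mulr0.
have := nz i.+1; have := nz i; rewrite addnS !exprS => nz0 nz1.
by field; rewrite nz0 nz1.
Qed.

(** Shifting the indicator of 1 gives that of 0, so each step adds one summand to the sum. Dividing
    by [q] avoids the exponent [n - M - 1], which is truncated at the base case [n = M]. *)
Lemma one_late_record_prob M n : (0 < M)%N -> (M <= n)%N ->
  E M n (fun c => (c == 1%N)%:R)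
  = (1 - q) / (1 - q ^+ n) * (q ^+ (n - M) / q) * (1 - q ^+ M)
    * \sum_(M <= j < n) 1 / (1 - q ^+ j).
Proof.
move=> M_gt0 /subnKC <-; rewrite addKn.
have nz i : 1 - q ^+ (M + i) != 0.
  by rewrite gt_eqF // one_minus_expr_gt0 // addn_gt0 M_gt0.
have q0 : q != 0 by rewrite gt_eqF.
elim: (n - M)%N => [|i IH].
  by rewrite addn0 late_records_mean_base big_geq // mulr0.
rewrite addnS late_records_meanS ?leq_addr // IH big_nat_recr ?leq_addr //=.
have -> : E M (M + i) ((fun c => (c == 1%N)%:R) \o succn)
        = E M (M + i) (fun c => (c == 0%N)%:R) by apply: eq_bigr.
rewrite no_late_record_prob ?leq_addr // addKn.
have := nz i.+1; have := nz i; rewrite addnS !exprS => nz0 nz1.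
by field; rewrite nz0 nz1 q0.
Qed.

(** For [M = 0] the formulas above would divide by [1 - q ^+ 0 = 0]. Here that same factor kills the
    term without a record: the first position always is one. *)
Lemma no_record_prob n : E 0 n.+1 (fun c => (c == 0%N)%:R) = 0.
Proof.
elim: n => [|n IH]; rewrite late_records_meanS //.
  by rewrite !late_records_mean_base /= expr0 subrr !mulr0 !mul0r addr0.
by rewrite IH mulr0 addr0 [E _ _ _]big1 ?mulr0 // => s _; rewrite /= mulr0.
Qed.

Lemma one_record_prob n :
  E 0 n.+1 (fun c => (c == 1%N)%:R) = (1 - q) / (1 - q ^+ n.+1) * q ^+ n.
Proof.
elim: n => [|n IH]; rewrite late_records_meanS //.
  by rewrite !late_records_mean_base /= expr0 !mulr1 mulr0 addr0.
have -> : E 0 n.+1 ((fun c => (c == 1%N)%:R) \o succn)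
        = E 0 n.+1 (fun c => (c == 0%N)%:R) by apply: eq_bigr.
rewrite no_record_prob IH.
have := @one_minus_expr_gt0 n.+1 isT; have := @one_minus_expr_gt0 n.+2 isT.
rewrite !exprS => /gt_eqF nz0 /gt_eqF nz1.
by field; rewrite nz0 nz1.
Qed.

Lemma success_probE n M : (M < n)%N ->
  success_prob n M q = E M n (fun c => (c == 1%N)%:R).
Proof.
move=> ltMn; rewrite /success_prob /mallowsP big_mkcond /=.
by apply: eq_bigr => s _; rewrite successE //; case: eqP; rewrite ?mulr1 ?mulr0.
Qed.

End RecordLaw.

Theorem theorem2 (R : realFieldType) (n M : nat) (q : R)
    (hn : (1 <= n)%N) (hM : (M <= n - 1)%N) (hq0 : 0 < q) (hq1 : q < 1) :
  success_prob n M q =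
    if (1 <= M)%N then
      (1 - q) / (1 - q ^+ n) * q ^+ (n - M - 1) * (1 - q ^+ M)
        * \sum_(M.+1 <= j < n.+1) 1 / (1 - q ^+ (j - 1))
    else
      (1 - q) / (1 - q ^+ n) * q ^+ (n - 1).
Proof.
have ltMn : (M < n)%N by lia.
rewrite success_probE //; case: ifPn => [M_gt0|]; last first.
  rewrite -eqn0Ngt => /eqP->; case: n {hM ltMn} hn => // n _.
  by rewrite one_record_prob // subn1.
rewrite one_late_record_prob ?(ltnW ltMn) // big_add1 /=.
under [in RHS]eq_bigr => j _ do rewrite subn1.
(* Since [M < n], the subtraction is not truncated and the division by [q] cancels. *)
have e : (n - M = (n - M - 1).+1)%N by lia.
by rewrite {1}e exprSr mulfK ?gt_eqF.
Qed.
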